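(* Let $A,B,P,Q$ be integers with $AB\neq 0$, $PQ\neq 0$ and $A^2>4B$. Define $(u_n)_{n\ge 0}$ by $u_0=P$, $u_1=Q$, $u_n=Au_{n-1}-Bu_{n-2}$ for $n\ge2$. Let $\alpha,\beta$ be the (real) roots of $x^2-Ax+B$ with $|\alpha|\ge|\beta|$, assume $\alpha/\beta$ is not a root of unity, let $D=\sqrt{A^2-4B}$, and assume $ab\neq0$ where $a=(Q-P\beta)/D$, $b=(Q-P\alpha)/D$. (i) If $|A-D|\ge 6\left|\frac QP\right|$, then for all $n\ge 6\left|\frac QP\right|+6$ we have $$|u_n|\ge |Q|\left(\frac{|\alpha|}{2}\right)^{n-2}\quad\text{and}\quad |u_n|\ge |Q|\left(\frac{\sqrt5}{2}\right)^n.$$ (ii) If $|A-D|<6\left|\frac QP\right|$, then for all $n\ge (18+7\log|Q|)\max\left(1,\left|\frac QP\right|\right)$ we have $$|u_n|\ge \min\left(\frac{1}{5|P|},\frac{1}{22|Q|}\right)|\alpha|^{n-2}\quad\text{and}\quad |u_n|\ge \min\left(\frac{1}{14|P|},\frac{1}{36|Q|}\right)\left(\frac{1+\sqrt5}{2}\right)^n.$$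
   Context: $\log$ denotes the natural logarithm; $D$ is the positive square root of $A^2-4B$.
   Formalization: The case threshold |A-D| is replaced by ||A|-D| (equal to it for A>0, and to 2|β| always), since for A<0 part (i) as printed fails, e.g. A=-100, B=1, P=100, Q=-1, n=7. *)

(* Defs.v *)
From Stdlib Require Export ZArith Reals.

Definition binary_recurrence (A B P Q : Z) (u : nat -> Z) : Prop :=
  (u 0%nat = P /\ u 1%nat = Q /\
   forall n : nat, (2 <= n)%nat ->
     u n = A * u (n - 1)%nat - B * u (n - 2)%nat)%Z.

(* [alpha] and [beta] are the two roots, with multiplicity. *)
Definition roots_of_charpoly (A B : Z) (alpha beta : R) : Prop :=
  (forall x : R,
     x ^ 2 - IZR A * x + IZR B = (x - alpha) * (x - beta))%R.

(* A real number is a root of unity in C iff one of its positive powers,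
   taken in R, is 1. *)
Definition root_of_unity (z : R) : Prop :=
  exists k : nat, (0 < k)%nat /\ (z ^ k = 1)%R.

(* Main.v *)
(** Put [s = |alpha|] and [m = |beta|].  Since [(s - m)^2] is one of the positive
    integers [A^2] and [A^2 - 4B], we have [s >= m + 1], whence
    [s (s - 1) >= s m = |B| >= 1] and [s] is at least the golden ratio.
    Everything rests on
    [(alpha - beta) u_n = (Q - P beta) alpha^n - (Q - P alpha) beta^n].
    In (i), grouping the right-hand side by [P] and [Q], the [P] part dominates as
    soon as [(s / m)^(n-1) >= 1 + (n-1) / m], which is Bernoulli's inequality.
    In (ii), [(Q - P alpha) (Q - P beta)] is a nonzero integer, so that
    [|Q - P beta| >= 1 / |Q - P alpha|], and it remains to see that
    [2 (|Q| + |P| s)^2 (m / s)^n <= 1]; this follows from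
    [ln (s / m) >= 2 / (7 max (1, |Q / P|))]. *)
Require Import Defs.
From Stdlib Require Import ZArith Reals Lra Lia.
Local Open Scope R_scope.

(** * Closed form of the sequence and sizes of the two roots *)

(** Both sides satisfy the same recurrence, so induction on pairs of consecutive terms works.
    Keeping [x - y] on the left avoids division. *)
Lemma binary_recurrence_closed_form (A B P Q : Z) (u : nat -> Z) (x y : R) :
  binary_recurrence A B P Q u -> x + y = IZR A -> x * y = IZR B ->
  forall n : nat,
    (x - y) * IZR (u n)
    = (IZR Q - IZR P * y) * x ^ n - (IZR Q - IZR P * x) * y ^ n.
Proof.
intros [u0 [u1 uS]] sumE prodE.
enough (H : forall n,
  (x - y) * IZR (u n)
    = (IZR Q - IZR P * y) * x ^ n - (IZR Q - IZR P * x) * y ^ n /\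
  (x - y) * IZR (u (S n))
    = (IZR Q - IZR P * y) * x ^ S n - (IZR Q - IZR P * x) * y ^ S n)
  by (intro n; apply H).
induction n as [|n [IH0 IH1]].
- rewrite u0, u1; split; simpl; ring.
- split; [exact IH1|].
  rewrite (uS (S (S n))) by lia.
  replace (S (S n) - 1)%nat with (S n) by lia.
  replace (S (S n) - 2)%nat with n by lia.
  rewrite minus_IZR, !mult_IZR, <- sumE, <- prodE.
  replace ((x - y) * ((x + y) * IZR (u (S n)) - x * y * IZR (u n)))
    with ((x + y) * ((x - y) * IZR (u (S n))) - x * y * ((x - y) * IZR (u n)))
    by ring.
  rewrite IH0, IH1; simpl; ring.
Qed.

Lemma roots_of_charpoly_sum_prod (A B : Z) (x y : R) :
  roots_of_charpoly A B x y -> x + y = IZR A /\ x * y = IZR B.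
Proof. intro H; generalize (H 0) (H 1); split; lra. Qed.

Lemma IZR_abs_ge1 (z : Z) : (z <> 0)%Z -> 1 <= Rabs (IZR z).
Proof. intro H; rewrite <- abs_IZR; apply IZR_le; lia. Qed.

Lemma Rsqr_abs_diff_cases (x y : R) :
  (Rabs x - Rabs y) ^ 2 = (x + y) ^ 2 \/ (Rabs x - Rabs y) ^ 2 = (x - y) ^ 2.
Proof.
unfold Rabs; destruct (Rcase_abs x), (Rcase_abs y);
  (left; ring) || (right; ring).
Qed.

Lemma roots_abs_gap (A B : Z) (x y : R) :
  x + y = IZR A -> x * y = IZR B -> (A <> 0)%Z -> (A ^ 2 > 4 * B)%Z ->
  Rabs y <= Rabs x -> Rabs y + 1 <= Rabs x.
Proof.
intros sumE prodE A0 disc yx.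
assert (sum1 : 1 <= (x + y) ^ 2).
{ rewrite sumE, pow_IZR; apply IZR_le; simpl; nia. }
assert (diff1 : 1 <= (x - y) ^ 2).
{ replace ((x - y) ^ 2) with ((x + y) ^ 2 - 4 * (x * y)) by ring.
  rewrite sumE, prodE, pow_IZR, <- mult_IZR, <- minus_IZR.
  apply IZR_le; simpl in *; lia. }
assert (gap : 1 <= (Rabs x - Rabs y) ^ 2)
  by (destruct (Rsqr_abs_diff_cases x y) as [-> | ->]; assumption).
nra.
Qed.

(** [|x + y|] and [|x - y|] are [|x| + |y|] and [|x| - |y|] in some order. With [x + y = A] and
    [|x - y| = D], the test separating (i) from (ii) becomes a comparison of [|beta|] with
    [3 |Q / P|]. *)
Lemma abs_sum_sub_abs_diff (x y : R) :
  Rabs y <= Rabs x -> Rabs (Rabs (x + y) - Rabs (x - y)) = 2 * Rabs y.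
Proof.
intro H.
destruct (Rcase_abs x) as [x0|x0], (Rcase_abs y) as [y0|y0];
  unfold Rabs in *; repeat destruct (Rcase_abs _); lra.
Qed.

(** Completing the square gives [(2 s - 1)^2 >= 5]. *)
Lemma golden_ratio_le (s : R) : 0 <= s -> 1 <= s * (s - 1) -> (1 + sqrt 5) / 2 <= s.
Proof.
intros s0 H.
enough (sqrt 5 <= 2 * s - 1) by lra.
rewrite <- (sqrt_pow2 (2 * s - 1)) by nra.
apply sqrt_le_1_alt; nra.
Qed.

Lemma sqrt5_bounds : 2.236 <= sqrt 5 <= 2.24.
Proof.
split.
- rewrite <- (sqrt_pow2 2.236) by lra; apply sqrt_le_1_alt; lra.
- rewrite <- (sqrt_pow2 2.24) by lra; apply sqrt_le_1_alt; lra.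
Qed.

(** * Lower bound for large [|beta|], case (i) *)

Lemma bernoulli_pow_le (m s : R) (k : nat) :
  0 < m -> m + 1 <= s -> (m + INR k) * m ^ k <= m * s ^ k.
Proof.
intros m0 ms.
assert (step : (m + INR k) * m ^ k <= m * (m + 1) ^ k).
{ induction k as [|k IH]; [simpl; lra|].
  assert (0 < m ^ k) by (apply pow_lt; lra).
  assert (0 <= INR k) by apply pos_INR.
  rewrite S_INR; simpl; nra. }
assert ((m + 1) ^ k <= s ^ k) by (apply pow_incr; lra).
nra.
Qed.

(** Used with [p = |P|], [q = |Q|], [d = D] and [w = |u_(k+1)|]; the last hypothesis is then the
    triangle inequality applied to the closed form grouped by [P] and [Q]. *)
Lemma large_beta_lower_bound (p q s m d w : R) (k : nat) :
  0 < p -> 0 < q -> 0 < m -> m + 1 <= s -> 0 <= w ->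
  3 * q <= m * p -> 6 * q <= p * INR k -> d <= 2 * s ->
  p * (s * m) * (s ^ k - m ^ k) - q * (s ^ S k + m ^ S k) <= d * w ->
  q * INR k * s ^ k <= 2 * (m + INR k) * w.
Proof.
intros p0 q0 m0 ms w0 small_q large_k ds lower.
generalize (bernoulli_pow_le m s k m0 ms); intro bern.
assert (Y0 : 0 < m ^ k) by (apply pow_lt; lra).
assert (X0 : 0 < s ^ k) by (apply pow_lt; lra).
simpl in lower.
set (X := s ^ k) in *; set (Y := m ^ k) in *; set (N := INR k) in *.
assert (N0 : 0 < N) by nra.
(* Bernoulli bounds the right side below by [3 (p m N - q N - 2 q m) X]. Since [3 q <= m p] and
   [6 q <= p N], each negative term costs at most a third of the main one. *)
assert (core : p * m * N * X <= 3 * (m + N) * (p * m * (X - Y) - q * (X + Y))).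
{ assert (e1 : q * N * X <= m * p / 3 * N * X).
  { apply Rmult_le_compat_r; [lra|]; apply Rmult_le_compat_r; lra. }
  assert (e2 : 2 * q * m * X <= p * N / 3 * m * X).
  { apply Rmult_le_compat_r; [lra|]; apply Rmult_le_compat_r; lra. }
  assert (e3 : (p * m + q) * ((m + N) * Y) <= (p * m + q) * (m * X)).
  { apply Rmult_le_compat_l; nra. }
  nra. }
assert (e4 : s * (p * m * (X - Y) - q * (X + Y)) <= 2 * s * w).
{ assert (q * (m * Y) <= q * (s * Y)).
  { apply Rmult_le_compat_l; [lra|]; apply Rmult_le_compat_r; lra. }
  assert (d * w <= 2 * s * w) by (apply Rmult_le_compat_r; lra).
  nra. }
assert (e5 : p * m * (X - Y) - q * (X + Y) <= 2 * w).
{ apply (Rmult_le_reg_l s); lra. }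
assert (e6 : 3 * q * (N * X) <= m * p * (N * X)).
{ apply Rmult_le_compat_r; [|lra]; nra. }
assert (e7 : 3 * (m + N) * (p * m * (X - Y) - q * (X + Y)) <= 3 * (m + N) * (2 * w)).
{ apply Rmult_le_compat_l; lra. }
nra.
Qed.

(** Since [m + k <= k * s], one factor [s] absorbs [(m + k) / k] and leaves
    [q * s ^ (k - 1) <= 2 * w]. The parameter [c] serves both bounds of (i). *)
Lemma le_of_gap_pow (q s m c w : R) (k : nat) :
  0 < q -> 0 < m -> m + 1 <= s -> (0 < k)%nat ->
  2 * c <= s ^ (k - 1) ->
  q * INR k * s ^ k <= 2 * (m + INR k) * w -> q * c <= w.
Proof.
intros q0 m0 ms k0 cs H.
assert (N1 : 1 <= INR k) by (apply (le_INR 1); lia).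
assert (E : s ^ k = s * s ^ (k - 1)) by (destruct k; [lia|]; simpl; rewrite Nat.sub_0_r; ring).
rewrite E in H.
assert (X0 : 0 < s ^ (k - 1)) by (apply pow_lt; lra).
set (X := s ^ (k - 1)) in *; set (N := INR k) in *.
assert (gap : m + N <= N * s) by nra.
assert (e1 : q * X * (m + N) <= q * X * (N * s)) by (apply Rmult_le_compat_l; nra).
assert (e2 : q * X <= 2 * w) by (apply (Rmult_le_reg_r (m + N)); nra).
nra.
Qed.

Lemma sqrt5_half_pow_le (s : R) (k : nat) :
  (1 + sqrt 5) / 2 <= s -> (5 <= k)%nat -> 2 * (sqrt 5 / 2) ^ S k <= s ^ (k - 1).
Proof.
intros phi_s k5; generalize sqrt5_bounds; intro b.
replace (S k) with (6 + (k - 5))%nat by lia.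
replace (k - 1)%nat with (4 + (k - 5))%nat by lia.
rewrite !pow_add, <- Rmult_assoc.
apply Rmult_le_compat.
- assert (0 <= (sqrt 5 / 2) ^ 6) by (apply pow_le; lra); lra.
- apply pow_le; lra.
(* [2 * 1.12 ^ 6] is below 4 and [1.6 ^ 4] above 6. *)
- apply Rle_trans with (2 * 1.12 ^ 6).
  { apply Rmult_le_compat_l; [lra|]; apply pow_incr; lra. }
  apply Rle_trans with (1.6 ^ 4); [lra|]; apply pow_incr; lra.
- apply pow_incr; lra.
Qed.

(** * Estimates for the logarithm and the exponential *)

Lemma ln_le_ln (x y : R) : 0 < x -> x <= y -> ln x <= ln y.
Proof.
intros x0 [H | ->]; [left; apply ln_increasing; assumption | right; reflexivity].
Qed.

(* The derivative of the difference is [t^2 / ((1 + t) (2 + t)^2)]. *)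
Lemma ln_1p_ge (t : R) : 0 < t -> 2 * t / (2 + t) <= ln (1 + t).
Proof.
intro t0.
destruct (MVT_cor2 (fun x => ln (1 + x) - 2 * x / (2 + x))
  (fun x => x ^ 2 / ((1 + x) * (2 + x) ^ 2)) 0 t t0) as [c [E c_in]].
{ intros c Hc.
  replace (c ^ 2 / ((1 + c) * (2 + c) ^ 2))
    with (/ (1 + c) * (0 + 1)
          - ((2 * 1) * (2 + c) - (0 + 1) * (2 * c)) / Rsqr (2 + c))
    by (unfold Rsqr; field; lra).
  apply derivable_pt_lim_minus.
  - apply (derivable_pt_lim_comp (fun x => 1 + x) ln).
    + apply derivable_pt_lim_plus;
        [apply derivable_pt_lim_const | apply derivable_pt_lim_id].
    + apply derivable_pt_lim_ln; lra.
  - apply (derivable_pt_lim_div (fun x => 2 * x) (fun x => 2 + x)); [| |lra].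
    + apply derivable_pt_lim_scal, derivable_pt_lim_id.
    + apply derivable_pt_lim_plus;
        [apply derivable_pt_lim_const | apply derivable_pt_lim_id]. }
rewrite Rplus_0_r, ln_1 in E.
assert (0 <= c ^ 2 / ((1 + c) * (2 + c) ^ 2) * (t - 0)).
{ apply Rmult_le_pos; [|lra]; apply Rle_mult_inv_pos; [nra|].
  apply Rmult_lt_0_compat; [lra|]; apply pow_lt; lra. }
lra.
Qed.

Lemma exp_le_exp (x y : R) : x <= y -> exp x <= exp y.
Proof.
intros [H | ->]; [left; apply exp_increasing; assumption | right; reflexivity].
Qed.

Lemma exp_INR_mult (n : nat) (x : R) : exp (INR n * x) = exp x ^ n.
Proof.
rewrite <- Rpower_pow by apply exp_pos.
unfold Rpower; now rewrite ln_exp.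
Qed.

(** In the threshold of (ii), the constant 18 contributes [18 * (2 / 7)] to the exponent, and this
    must beat [2 * 5 ^ 2]. *)
Lemma exp_36_7_ge : 50 <= exp (36 / 7).
Proof.
apply Rle_trans with (exp (1 / 2) ^ 10).
- apply Rle_trans with ((3 / 2) ^ 10); [lra|].
  apply pow_incr; generalize (exp_ineq1 (1 / 2)); lra.
- rewrite <- exp_INR_mult; apply exp_le_exp; simpl; lra.
Qed.

(** [s / m >= 1 + 1 / m >= 1 + 1 / (3 K)], and [2 t / (2 + t)] at [t = 1 / (3 K)] equals
    [2 / (6 K + 1)], which is at least [2 / (7 K)]. *)
Lemma ratio_log_ge (s m K : R) :
  0 < m -> m + 1 <= s -> 1 <= K -> m <= 3 * K -> 2 / (7 * K) <= ln (s / m).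
Proof.
intros m0 ms K1 mK.
apply Rle_trans with (ln (1 + 1 / (3 * K))).
- apply Rle_trans with (2 * (1 / (3 * K)) / (2 + 1 / (3 * K))).
  + replace (2 * (1 / (3 * K)) / (2 + 1 / (3 * K))) with (2 / (6 * K + 1))
      by (field; lra).
    apply Rmult_le_compat_l; [lra|]; apply Rinv_le_contravar; lra.
  + apply ln_1p_ge, Rdiv_lt_0_compat; lra.
- assert (1 / (3 * K) <= 1 / m).
  { apply Rmult_le_compat_l; [lra|]; apply Rinv_le_contravar; lra. }
  assert (0 < 1 / (3 * K)) by (apply Rdiv_lt_0_compat; lra).
  apply ln_le_ln; [lra|].
  apply Rle_trans with ((m + 1) / m).
  + replace ((m + 1) / m) with (1 + 1 / m) by (field; lra); lra.
  + apply Rmult_le_compat_r; [left; apply Rinv_0_lt_compat|]; lra.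
Qed.

(** * Lower bound for small [|beta|], case (ii) *)

(** If [p s <= 4 q], the left factor is at most [50 q^2], and the logarithmic bound gives
    [n L >= 36 / 7 + 2 ln q]. For larger [s] that bound is too weak, but then [s / m] itself grows
    with [s]. *)
Lemma small_beta_decay (p q s m : R) (n : nat) :
  0 < p -> 1 <= q -> 0 < m -> m + 1 <= s -> m * p <= 3 * q ->
  (18 + 7 * ln q) * Rmax 1 (q / p) <= INR n ->
  2 * (q + p * s) ^ 2 * m ^ n <= s ^ n.
Proof.
intros p0 q1 m0 ms mpq large_n.
assert (K1 : 1 <= Rmax 1 (q / p)) by apply Rmax_l.
assert (mK : m <= 3 * Rmax 1 (q / p)).
{ apply Rle_trans with (3 * (q / p)).
  - apply (Rmult_le_reg_r p); [lra|].
    replace (3 * (q / p) * p) with (3 * q) by (field; lra); lra.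
  - apply Rmult_le_compat_l; [lra|apply Rmax_r]. }
generalize (ratio_log_ge s m _ m0 ms K1 mK); intro L_K.
set (K := Rmax 1 (q / p)) in *; set (L := ln (s / m)) in *.
assert (lnq : 0 <= ln q) by (rewrite <- ln_1; apply ln_le_ln; lra).
assert (r0 : 0 < s / m) by (apply Rdiv_lt_0_compat; lra).
assert (q2 : q ^ 2 = exp (2 * ln q)).
{ rewrite <- (exp_ln q) at 1 by lra; rewrite <- exp_INR_mult; reflexivity. }
assert (ratio_pow : 2 * (q + p * s) ^ 2 <= (s / m) ^ n).
{ replace ((s / m) ^ n) with (exp (INR n * L))
    by (unfold L; rewrite <- Rpower_pow by exact r0; reflexivity).
  destruct (Rle_lt_dec (p * s) (4 * q)) as [ps | ps].
  - apply Rle_trans with (50 * q ^ 2).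
    { assert ((q + p * s) ^ 2 <= (5 * q) ^ 2) by (apply pow_incr; nra); lra. }
    apply Rle_trans with (exp (36 / 7) * q ^ 2).
    { apply Rmult_le_compat_r; [nra|exact exp_36_7_ge]. }
    rewrite q2, <- exp_plus; apply exp_le_exp.
    apply Rle_trans with ((18 + 7 * ln q) * K * (2 / (7 * K))).
    { right; field; lra. }
    apply Rmult_le_compat; try lra; [apply Rmult_le_pos; lra|].
    left; apply Rdiv_lt_0_compat; lra.
  (* [m p <= 3 q] gives [s / m >= z], and [p s = 3 q z] expresses the target in [z] and [q]. As
     [ln z >= 2 / 7], the term [7 ln q] of the threshold yields the factor [q^2], and 18 yields
     [z^18]. *)
  - set (z := p * s / (3 * q)).
    assert (z43 : 4 / 3 <= z).
    { unfold z; apply (Rmult_le_reg_r (3 * q)); [lra|].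
      replace (p * s / (3 * q) * (3 * q)) with (p * s) by (field; lra); lra. }
    assert (zr : z <= s / m).
    { unfold z; apply (Rmult_le_reg_r (3 * q * m)); [nra|].
      replace (p * s / (3 * q) * (3 * q * m)) with (m * p * s) by (field; lra).
      replace (s / m * (3 * q * m)) with (3 * q * s) by (field; lra).
      apply Rmult_le_compat_r; lra. }
    assert (Lz : ln z <= L) by (apply ln_le_ln; lra).
    assert (z27 : 2 / 7 <= ln z).
    { apply Rle_trans with (ln (1 + 1 / 3)); [|apply ln_le_ln; lra].
      apply Rle_trans with (2 * (1 / 3) / (2 + 1 / 3)); [lra|].
      apply ln_1p_ge; lra. }
    apply Rle_trans with (z ^ 18 * q ^ 2).
    + replace (p * s) with (3 * q * z) by (unfold z; field; lra).
      replace (2 * (q + 3 * q * z) ^ 2) with (2 * (1 + 3 * z) ^ 2 * q ^ 2) by ring.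
      apply Rmult_le_compat_r; [nra|].
      (* [(4 / 3) ^ 16] exceeds 90, and [2 (1 + 3 z)^2 <= 90 z^2] for [z >= 4 / 3]. *)
      assert ((4 / 3) ^ 16 <= z ^ 16) by (apply pow_incr; lra).
      replace (z ^ 18) with (z ^ 16 * z ^ 2) by ring.
      apply Rle_trans with ((4 / 3) ^ 16 * z ^ 2); [|nra].
      apply Rle_trans with (90 * z ^ 2); [nra|].
      apply Rmult_le_compat_r; [nra|lra].
    + rewrite q2, <- Rpower_pow by lra; unfold Rpower.
      rewrite <- exp_plus; apply exp_le_exp.
      apply Rle_trans with ((18 + 7 * ln q) * ln z).
      { replace (INR 18) with 18 by (simpl; ring); nra. }
      apply Rmult_le_compat; try lra; nra. }
assert (M0 : 0 < m ^ n) by (apply pow_lt; lra).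
apply Rle_trans with ((s / m) ^ n * m ^ n).
- apply Rmult_le_compat_r; lra.
- rewrite <- Rpow_mult_distr; right; f_equal; field; lra.
Qed.

(** Multiplying the last hypothesis by [g] turns [f * g >= 1] into
    [s ^ n - g ^ 2 * m ^ n <= 2 * s * h * w], and the decay hypothesis makes the subtracted term at
    most half of [s ^ n]. *)
Lemma norm_form_lower_bound (f g h s m d w : R) (n : nat) :
  0 < g -> g <= h -> 1 <= f * g -> 0 < s -> 0 < m -> 0 <= w -> d <= 2 * s ->
  2 * h ^ 2 * m ^ n <= s ^ n -> f * s ^ n - g * m ^ n <= d * w ->
  s ^ n <= 4 * s * h * w.
Proof.
intros g0 gh fg s0 m0 w0 ds decay lower.
assert (0 < m ^ n) by (apply pow_lt; lra).
assert (0 < s ^ n) by (apply pow_lt; lra).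
set (X := s ^ n) in *; set (Y := m ^ n) in *.
assert (e1 : g * (f * X - g * Y) <= g * (d * w)) by (apply Rmult_le_compat_l; lra).
assert (e2 : g ^ 2 * Y <= h ^ 2 * Y).
{ apply Rmult_le_compat_r; [lra|]; apply pow_incr; lra. }
assert (e3 : 1 * X <= f * g * X) by (apply Rmult_le_compat_r; lra).
assert (e4 : g * (d * w) <= h * (2 * s * w)).
{ apply Rle_trans with (g * (2 * s * w)).
  - apply Rmult_le_compat_l; [lra|]; apply Rmult_le_compat_r; lra.
  - apply Rmult_le_compat_r; [nra|lra]. }
nra.
Qed.

Lemma Rmin_inv_mul_le (c1 c2 p q X w : R) :
  0 < c1 -> 0 < c2 -> 0 < p -> 0 < q -> 0 <= X ->
  (X <= c1 * p * w \/ X <= c2 * q * w) ->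
  Rmin (1 / (c1 * p)) (1 / (c2 * q)) * X <= w.
Proof.
intros c10 c20 p0 q0 X0 [H | H].
- assert (cp : 0 < c1 * p) by nra.
  apply Rle_trans with (1 / (c1 * p) * X).
  + apply Rmult_le_compat_r; [lra|apply Rmin_l].
  + apply (Rmult_le_reg_l (c1 * p)); [lra|].
    replace (c1 * p * (1 / (c1 * p) * X)) with X by (field; lra); lra.
- assert (cq : 0 < c2 * q) by nra.
  apply Rle_trans with (1 / (c2 * q) * X).
  + apply Rmult_le_compat_r; [lra|apply Rmin_r].
  + apply (Rmult_le_reg_l (c2 * q)); [lra|].
    replace (c2 * q * (1 / (c2 * q) * X)) with X by (field; lra); lra.
Qed.

(** Cancelling [s] twice, with [s >= phi] in the [q] term, gives [X <= 2.48 q w + 4 p w] for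
    [X = s ^ k], as [4 / phi < 2.48]. The constants in both minima follow from this. *)
Lemma small_beta_bounds (p q s w : R) (k : nat) :
  0 < p -> 0 < q -> 0 <= w -> (1 + sqrt 5) / 2 <= s ->
  s ^ S (S k) <= 4 * s * (q + p * s) * w ->
  Rmin (1 / (5 * p)) (1 / (22 * q)) * s ^ k <= w /\
  Rmin (1 / (14 * p)) (1 / (36 * q)) * ((1 + sqrt 5) / 2) ^ S (S k) <= w.
Proof.
intros p0 q0 w0 phi_s lower.
generalize sqrt5_bounds; intro b.
assert (phi2 : ((1 + sqrt 5) / 2) ^ 2 = (1 + sqrt 5) / 2 + 1).
{ assert (sqrt 5 * sqrt 5 = 5) by (apply sqrt_sqrt; lra); simpl; lra. }
set (phi := (1 + sqrt 5) / 2) in *.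
assert (phi_b : 1.618 <= phi <= 1.62) by (unfold phi; lra).
clearbody phi; simpl in lower |- *.
assert (X0 : 0 < s ^ k) by (apply pow_lt; lra).
assert (Z0 : 0 < phi ^ k) by (apply pow_lt; lra).
assert (ZX : phi ^ k <= s ^ k) by (apply pow_incr; lra).
set (X := s ^ k) in *; set (Z := phi ^ k) in *.
assert (e1 : s * X <= 4 * (q + p * s) * w) by (apply (Rmult_le_reg_l s); lra).
assert (qw : 0 <= q * w) by nra.
assert (pw : 0 <= p * w) by nra.
assert (e2 : phi * X <= 4 * (q * w) + 4 * phi * (p * w)).
{ apply (Rmult_le_reg_l s); [lra|].
  assert (phi * (s * X) <= phi * (4 * (q + p * s) * w))
    by (apply Rmult_le_compat_l; lra).
  assert (phi * (q * w) <= s * (q * w)) by (apply Rmult_le_compat_r; lra).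
  nra. }
assert (e3 : X <= 2.48 * (q * w) + 4 * (p * w)).
{ apply (Rmult_le_reg_l phi); [lra|].
  assert (1.618 * (q * w) <= phi * (q * w)) by (apply Rmult_le_compat_r; lra).
  lra. }
split; apply Rmin_inv_mul_le; try lra.
- assert (0 <= phi * Z) by nra; nra.
- assert (e4 : phi * (phi * Z) <= 2.62 * Z) by (simpl in phi2; nra).
  (* Multiplied by 2.62, the bound [e3] is below [6.5 q w + 10.5 p w]: at most [14 p w] in the first
     case and [36 q w] in the second. *)
  destruct (Rle_lt_dec (2 * (q * w)) (p * w)); [left|right]; lra.
Qed.

(* The threshold is written with | |A| - D |, which is |A - D| when A > 0 and
   equals 2 |beta| for either sign of A.  With |A - D| itself the first part
   is false for some A < 0, e.g. (A, B, P, Q) = (-100, 1, 100, -1), n = 7. *)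
Theorem theorem2p2 :
  forall (A B P Q : Z) (u : nat -> Z) (alpha beta : R),
  (A * B <> 0)%Z -> (P * Q <> 0)%Z -> (A ^ 2 > 4 * B)%Z ->
  binary_recurrence A B P Q u ->
  roots_of_charpoly A B alpha beta ->
  Rabs alpha >= Rabs beta ->
  ~ root_of_unity (alpha / beta) ->
  let D := sqrt (IZR A ^ 2 - 4 * IZR B) in
  let a := (IZR Q - IZR P * beta) / D in
  let b := (IZR Q - IZR P * alpha) / D in
  a * b <> 0 ->
  (Rabs (Rabs (IZR A) - D) >= 6 * Rabs (IZR Q / IZR P) ->
   forall n : nat, INR n >= 6 * Rabs (IZR Q / IZR P) + 6 ->
     Rabs (IZR (u n)) >= Rabs (IZR Q) * (Rabs alpha / 2) ^ (n - 2) /\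
     Rabs (IZR (u n)) >= Rabs (IZR Q) * (sqrt 5 / 2) ^ n) /\
  (Rabs (Rabs (IZR A) - D) < 6 * Rabs (IZR Q / IZR P) ->
   forall n : nat,
     INR n >= (18 + 7 * ln (Rabs (IZR Q))) * Rmax 1 (Rabs (IZR Q / IZR P)) ->
     Rabs (IZR (u n)) >=
       Rmin (1 / (5 * Rabs (IZR P))) (1 / (22 * Rabs (IZR Q)))
         * Rabs alpha ^ (n - 2) /\
     Rabs (IZR (u n)) >=
       Rmin (1 / (14 * Rabs (IZR P))) (1 / (36 * Rabs (IZR Q)))
         * ((1 + sqrt 5) / 2) ^ n).
Proof.
intros A B P Q u alpha beta AB0 PQ0 disc rec roots ab_le _ D a b ab0.
destruct (roots_of_charpoly_sum_prod _ _ _ _ roots) as [sumE prodE].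
assert (A0 : A <> 0%Z) by (intros ->; lia).
assert (B0 : B <> 0%Z) by (intros ->; lia).
assert (P0 : P <> 0%Z) by (intros ->; lia).
assert (Q0 : Q <> 0%Z) by (intros ->; lia).
assert (ab_le' : Rabs beta <= Rabs alpha) by lra.
generalize (roots_abs_gap A B alpha beta sumE prodE A0 disc ab_le'); intro gap.
assert (DE : D = Rabs (alpha - beta)).
{ unfold D; rewrite <- sqrt_Rsqr_abs; f_equal.
  rewrite <- sumE, <- prodE; unfold Rsqr; ring. }
assert (abs_prod : 1 <= Rabs alpha * Rabs beta).
{ rewrite <- Rabs_mult, prodE; apply IZR_abs_ge1, B0. }
assert (D2 : D <= 2 * Rabs alpha).
{ rewrite DE; generalize (Rabs_triang alpha (- beta)); rewrite Rabs_Ropp.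
  fold (alpha - beta); lra. }
assert (m0 : 0 < Rabs beta) by (generalize (Rabs_pos beta); nra).
assert (phi_s : (1 + sqrt 5) / 2 <= Rabs alpha) by (apply golden_ratio_le; nra).
assert (p1 : 1 <= Rabs (IZR P)) by (apply IZR_abs_ge1, P0).
assert (q1 : 1 <= Rabs (IZR Q)) by (apply IZR_abs_ge1, Q0).
assert (absA : Rabs (Rabs (IZR A) - D) = 2 * Rabs beta).
{ rewrite DE, <- sumE; apply abs_sum_sub_abs_diff, ab_le'. }
assert (closed : forall n, D * Rabs (IZR (u n))
  = Rabs ((IZR Q - IZR P * beta) * alpha ^ n - (IZR Q - IZR P * alpha) * beta ^ n)).
{ intro n; rewrite DE, <- Rabs_mult; f_equal.
  apply (binary_recurrence_closed_form A B P Q); assumption. }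
assert (ratioE : Rabs (IZR Q / IZR P) = Rabs (IZR Q) / Rabs (IZR P)).
{ unfold Rdiv; rewrite Rabs_mult, Rabs_inv; reflexivity. }
rewrite absA, ratioE; clear absA ratioE.
assert (qp : Rabs (IZR Q) / Rabs (IZR P) * Rabs (IZR P) = Rabs (IZR Q)) by (field; lra).
assert (qp0 : 0 < Rabs (IZR Q) / Rabs (IZR P)) by (apply Rdiv_lt_0_compat; lra).
split; intros beta_cmp n large_n.
- destruct n as [|k]; [simpl in large_n; lra|].
  rewrite S_INR in large_n.
  (* The threshold reads [k >= 6 |Q / P| + 5]: the first term feeds [large_beta_lower_bound], the
     second [sqrt5_half_pow_le]. *)
  assert (k5 : (5 <= k)%nat) by (apply INR_le; simpl; lra).
  assert (main : Rabs (IZR Q) * INR k * Rabs alpha ^ k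
                 <= 2 * (Rabs beta + INR k) * Rabs (IZR (u (S k)))).
  { apply (large_beta_lower_bound (Rabs (IZR P)) _ _ _ D);
      try lra; try apply Rabs_pos; try nra.
    rewrite closed.
    replace ((IZR Q - IZR P * beta) * alpha ^ S k - (IZR Q - IZR P * alpha) * beta ^ S k)
      with (IZR Q * (alpha ^ S k - beta ^ S k)
            - IZR P * (alpha * beta) * (alpha ^ k - beta ^ k)) by (simpl; ring).
    rewrite Rabs_minus_sym.
    eapply Rle_trans; [|apply Rabs_triang_inv].
    rewrite !Rabs_mult, !RPow_abs.
    assert (c1 := Rabs_triang_inv (alpha ^ k) (beta ^ k)).
    assert (c2 := Rabs_triang (alpha ^ S k) (- beta ^ S k)).
    rewrite Rabs_Ropp in c2; fold (alpha ^ S k - beta ^ S k) in c2.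
    apply Rplus_le_compat.
    - apply Rmult_le_compat_l; [nra|exact c1].
    - apply Ropp_le_contravar, Rmult_le_compat_l; [lra|exact c2]. }
  split; apply Rle_ge.
  + apply (le_of_gap_pow _ (Rabs alpha) (Rabs beta) _ _ k); try lra; try lia.
    replace (S k - 2)%nat with (k - 1)%nat by lia.
    unfold Rdiv; rewrite Rpow_mult_distr, pow_inv.
    assert (0 < Rabs alpha ^ (k - 1)) by (apply pow_lt; lra).
    assert (2 <= 2 ^ (k - 1)).
    { replace 2 with (2 ^ 1) at 1 by ring; apply Rle_pow; [lra|lia]. }
    assert (/ 2 ^ (k - 1) <= / 2) by (apply Rinv_le_contravar; lra).
    nra.
  + apply (le_of_gap_pow _ (Rabs alpha) (Rabs beta) _ _ k); try lra; try lia.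
    apply sqrt5_half_pow_le; assumption.
- assert (lnq : 0 <= ln (Rabs (IZR Q))) by (rewrite <- ln_1; apply ln_le_ln; lra).
  assert (K1 : 1 <= Rmax 1 (Rabs (IZR Q) / Rabs (IZR P))) by apply Rmax_l.
  (* The threshold is at least 18, so 0 and 1 are excluded and [n - 2] is not truncated. *)
  destruct n as [|[|k]]; [simpl in large_n; nra | simpl in large_n; nra |].
  replace (S (S k) - 2)%nat with k by lia.
  enough (main : Rabs alpha ^ S (S k)
    <= 4 * Rabs alpha * (Rabs (IZR Q) + Rabs (IZR P) * Rabs alpha)
         * Rabs (IZR (u (S (S k))))).
  { split; apply Rle_ge, (small_beta_bounds _ _ (Rabs alpha) _ k);
      try lra; apply Rabs_pos. }
  set (n := S (S k)) in *.
  (* This product divided by [D ^ 2] is [a * b]. *)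
  assert (norm0 : (IZR Q - IZR P * beta) * (IZR Q - IZR P * alpha) <> 0).
  { intro E; apply ab0; unfold a, b, Rdiv.
    replace ((IZR Q - IZR P * beta) * / D * ((IZR Q - IZR P * alpha) * / D))
      with ((IZR Q - IZR P * beta) * (IZR Q - IZR P * alpha) * (/ D * / D)) by ring.
    rewrite E; ring. }
  assert (normE : (IZR Q - IZR P * beta) * (IZR Q - IZR P * alpha)
                  = IZR (Q * Q - A * P * Q + B * P * P)).
  { rewrite plus_IZR, minus_IZR, !mult_IZR, <- sumE, <- prodE; ring. }
  assert (norm1 : 1 <= Rabs (IZR Q - IZR P * beta) * Rabs (IZR Q - IZR P * alpha)).
  { rewrite <- Rabs_mult, normE; apply IZR_abs_ge1; intro E.
    apply norm0; rewrite normE, E; reflexivity. }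
  apply (norm_form_lower_bound (Rabs (IZR Q - IZR P * beta))
           (Rabs (IZR Q - IZR P * alpha)) _ _ (Rabs beta) D);
    try assumption; try lra; try apply Rabs_pos.
  + apply Rabs_pos_lt; intro E; apply norm0; rewrite E; ring.
  + generalize (Rabs_triang (IZR Q) (- (IZR P * alpha))).
    rewrite Rabs_Ropp, Rabs_mult; intro H; exact H.
  + apply small_beta_decay; try lra; nra.
  + rewrite closed.
    eapply Rle_trans; [|apply Rabs_triang_inv].
    rewrite !Rabs_mult, !RPow_abs; lra.
Qed.
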